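(* Let $N\ge 2$ and let $\Omega\subset\mathbb{R}^N$ be a bounded domain with $C^2$-boundary. Let $\kappa_i(x)$, $i=1,\ldots,N-1$, denote the principal curvatures of $\partial\Omega$ at $x\in\partial\Omega$, set $$\underline{\kappa}=\min\{\kappa_i(x)\,:\,i=1,\ldots,N-1,\ x\in\partial\Omega\},$$ and assume that $\underline{\kappa}>0$. If $R\ge 1/\underline{\kappa}$, then $\Omega\in\mathcal{C}_R$, i.e. there exists a set $Y\subset\mathbb{R}^N$ such that $$\Omega=\bigcap_{y\in Y}B_R(y).$$
   Context: $B_R(y)$ is the open ball of radius $R$ centred at $y$. A domain is a nonempty open connected set. Principal curvatures are taken with the sign convention for which the boundary of a ball of radius $r$ has all principal curvatures equal to $1/r>0$. $\mathcal{C}_R$ denotes the class of bounded domains $\Omega\subset\mathbb{R}^N$ which can be written as $\Omega=\bigcap_{y\in Y}B_R(y)$ for some $Y\subset\mathbb{R}^N$. *)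

(* Defs.v *)
From HB Require Import structures.
From mathcomp Require Import all_boot all_order all_algebra.
From mathcomp Require Import all_classical all_reals all_analysis.

Set Implicit Arguments.
Unset Strict Implicit.
Unset Printing Implicit Defensive.

Import Order.TTheory GRing.Theory Num.Theory.
Import numFieldNormedType.Exports.

Local Open Scope classical_set_scope.
Local Open Scope ring_scope.

(* The library norm `|x| on 'rV[R]_N is the sup norm.  It gives the same open,
   connected and bounded sets and the same differentials as the Euclidean norm,
   so the library notions are used for these; balls and unit normals need the
   Euclidean structure below. *)

Definition dotp (R : realType) (N : nat) (u v : 'rV[R]_N) : R :=
  \sum_(i < N) u 0 i * v 0 i.

Definition enorm (R : realType) (N : nat) (u : 'rV[R]_N) : R :=
  Num.sqrt (dotp u u).

Definition eball (R : realType) (N : nat) (y : 'rV[R]_N) (r : R) :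
    set 'rV[R]_N :=
  [set x | enorm (x - y) < r].

Definition domain (R : realType) (N : nat) (Omega : set 'rV[R]_N) : Prop :=
  [/\ Omega !=set0, open Omega & connected Omega].

Definition boundary (R : realType) (N : nat) (Omega : set 'rV[R]_N) :
    set 'rV[R]_N :=
  closure Omega `\` interior Omega.

Definition C1_on (R : realType) (N : nat) (U : set 'rV[R]_N)
    (f : 'rV[R]_N -> R) : Prop :=
  forall x, U x ->
    differentiable f x /\ forall v, {for x, continuous ('D_v f)}.

Definition C2_on (R : realType) (N : nat) (U : set 'rV[R]_N)
    (f : 'rV[R]_N -> R) : Prop :=
  C1_on U f /\ forall v, C1_on U ('D_v f).

Definition grad (R : realType) (N : nat) (f : 'rV[R]_N -> R) (x : 'rV[R]_N) :
    'rV[R]_N :=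
  \row_(i < N) 'D_(delta_mx 0 i) f x.

(* Since grad g does not vanish on U, the boundary of Omega inside U is the
   level set g = 0.  A local graph representation x_N > gamma (x_1 .. x_(N-1))
   of Omega (in some Euclidean frame) is the case g = gamma - x_N. *)
Definition local_defining (R : realType) (N : nat) (Omega : set 'rV[R]_N)
    (p : 'rV[R]_N) (U : set 'rV[R]_N) (g : 'rV[R]_N -> R) : Prop :=
  [/\ open U /\ U p,
      C2_on U g,
      forall x, U x -> grad g x != 0 &
      forall x, U x -> (Omega x <-> g x < 0)].

Definition C2_boundary (R : realType) (N : nat) (Omega : set 'rV[R]_N) : Prop :=
  forall p, boundary Omega p -> exists U g, local_defining Omega p U g.

(* On the boundary this is the outward unit normal, since g < 0 inside. *)
Definition unit_normal (R : realType) (N : nat) (g : 'rV[R]_N -> R)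
    (x : 'rV[R]_N) : 'rV[R]_N :=
  (enorm (grad g x))^-1 *: grad g x.

(* Eigenvalues of the shape operator: the differential at p of the outward unit
   normal, restricted to the tangent space, i.e. the orthogonal complement of
   the normal.  With the outward normal the sphere of radius r has curvatures
   1/r.  The restriction does not depend on the choice of (U, g), as the normal
   on the boundary does not. *)
Definition principal_curvature (R : realType) (N : nat) (Omega : set 'rV[R]_N)
    (p : 'rV[R]_N) (k : R) : Prop :=
  exists U g, local_defining Omega p U g /\
    exists v : 'rV[R]_N,
      [/\ v != 0, dotp (unit_normal g p) v = 0 &
          'd (unit_normal g) p v = k *: v].

(* For N >= 2 and Omega bounded, nonempty, with C^2 boundary, the set below is
   nonempty and compact, so that its infimum is its minimum. *)
Definition min_curvature (R : realType) (N : nat) (Omega : set 'rV[R]_N) : R :=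
  inf [set k | exists2 p, boundary Omega p & principal_curvature Omega p k].

Definition class_C (R : realType) (N : nat) (r : R) : set (set 'rV[R]_N) :=
  [set Omega | [/\ domain Omega, bounded_set Omega &
     exists Y : set 'rV[R]_N, Omega = \bigcap_(y in Y) eball y r]].

(* Main.v *)
Require Import Defs.
From HB Require Import structures.
From mathcomp Require Import all_boot all_order all_algebra.
From mathcomp Require Import all_classical all_reals all_analysis.
From mathcomp Require Import ring lra.

Set Implicit Arguments.
Unset Strict Implicit.
Unset Printing Implicit Defensive.

Import Order.TTheory GRing.Theory Num.Theory.
Import numFieldNormedType.Exports.

Local Open Scope classical_set_scope.
Local Open Scope ring_scope.

(** Let q be a boundary point with outward unit normal nu.  If all principal
    curvatures at q are at least kappa and r > 1 / kappa, then near q the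
    closure of Omega lies in the ball of radius r that touches the boundary at q
    from inside, q - r nu being its centre (local_defining_in_ball).  This is
    Taylor's formula for a defining function g: the shape operator is the
    tangential part of the Hessian of g divided by |grad g|, it is symmetric by
    Schwarz's theorem, so its Rayleigh quotient attains its minimum at an
    eigenvector and is at least kappa (tangential_hessian_ge).

    The passage to the whole of Omega uses these local supporting balls only,
    and always the same contradiction: if a circular arc of radius rho >= r (or
    a segment) stays in the closure of Omega and a boundary point q is one of its
    interior points, then it is tangent to the boundary at q and curves no more
    than the sphere of radius r there, so it cannot enter the open supporting
    ball on both sides of q.

    - Omega is convex (segment_closed_of_supported): for fixed x, the set of
      points y of Omega whose segment to x stays in Omega is open and closed in
      Omega.
    - Omega contains the arcs of radius at least r between its points that are
      at most half-circles (arc_region_sub): bend the segment from x to y gradually; the first arc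
      that meets the boundary gives the contradiction.
    - Omega lies in the ball touching its boundary at p (sub_tangent_ball): if y
      in Omega were outside, an arc of radius at least r from p to y would leave
      p on the outer side of the sphere, and it would be in the closure of Omega,
      against the local support at p.

    Letting r decrease to 1 / kappa gives the same global inclusion for every
    r >= 1 / kappa, and a point z outside Omega is separated from Omega by the
    ball that touches the boundary where a segment from Omega to z first leaves
    Omega (class_C_of_local_support). *)

(** * The Euclidean scalar product *)

Section Dotp.
Context {R : realType} {N : nat}.
Implicit Types (u v w : 'rV[R]_N) (a : R).

Lemma dotpC u v : dotp u v = dotp v u.
Proof. by apply: eq_bigr => i _; rewrite mulrC. Qed.

Lemma dotpDl u v w : dotp (u + v) w = dotp u w + dotp v w.
Proof. by rewrite -big_split; apply: eq_bigr => i _; rewrite mxE mulrDl. Qed.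

Lemma dotpDr u v w : dotp w (u + v) = dotp w u + dotp w v.
Proof. by rewrite dotpC dotpDl !(dotpC _ w). Qed.

Lemma dotpZl a u v : dotp (a *: u) v = a * dotp u v.
Proof. by rewrite mulr_sumr; apply: eq_bigr => i _; rewrite mxE mulrA. Qed.

Lemma dotpZr a u v : dotp u (a *: v) = a * dotp u v.
Proof. by rewrite dotpC dotpZl dotpC. Qed.

Lemma dotpNl u v : dotp (- u) v = - dotp u v.
Proof. by rewrite -scaleN1r dotpZl mulN1r. Qed.

Lemma dotpNr u v : dotp u (- v) = - dotp u v.
Proof. by rewrite dotpC dotpNl dotpC. Qed.

Definition dotpE := (dotpDl, dotpDr, dotpNl, dotpNr, dotpZl, dotpZr).

Lemma dotp_ge0 u : 0 <= dotp u u.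
Proof. by apply: sumr_ge0 => i _; rewrite -expr2 sqr_ge0. Qed.

Lemma dotp_eq0 u : (dotp u u == 0) = (u == 0).
Proof.
apply/eqP/eqP => [u0|->]; last by apply: big1 => i _; rewrite mxE mul0r.
have u2 (i : 'I_N) : true -> 0 <= u 0 i * u 0 i by rewrite -expr2 sqr_ge0.
apply/rowP => i; rewrite mxE; apply/eqP.
by rewrite -sqrf_eq0 expr2 (psumr_eq0P u2 u0).
Qed.

Lemma dotp_gt0 u : (0 < dotp u u) = (u != 0).
Proof. by rewrite lt0r dotp_eq0 dotp_ge0 andbT. Qed.

Lemma cauchy_schwarz u v : dotp u v ^+ 2 <= dotp u u * dotp v v.
Proof.
have [->|v0] := eqVneq v 0; first by rewrite -(scale0r 0) !dotpZr !mul0r mulr0 expr0n.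
have vv : 0 < dotp v v by rewrite dotp_gt0.
have := dotp_ge0 (dotp v v *: u - dotp u v *: v).
rewrite !dotpE (dotpC v u).
set a := dotp u v; set b := dotp u u; set c := dotp v v in vv *.
rewrite [leRHS](_ : _ = c * (b * c - a ^+ 2)); last by ring.
by rewrite pmulr_rge0// subr_ge0.
Qed.

Lemma cvg_dotp {T : Type} {F : set_system T} {FF : Filter F}
    (f g : T -> 'rV[R]_N) u v :
  f @ F --> u -> g @ F --> v -> dotp (f t) (g t) @[t --> F] --> dotp u v.
Proof.
move=> fu gv; apply: cvg_big => [|i _]; first exact: add_continuous.
apply: cvgM.
- exact: (cvg_comp _ _ fu (@coord_continuous _ _ _ 0 i u)).
- exact: (cvg_comp _ _ gv (@coord_continuous _ _ _ 0 i v)).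
Qed.

Lemma eball_sqr u c a : 0 <= a -> eball c a u <-> dotp (u - c) (u - c) < a ^+ 2.
Proof.
move=> a0; rewrite /eball /enorm /=; set d := dotp _ _.
have d0 : 0 <= d by exact: dotp_ge0.
rewrite -[X in X < _ ^+ _](sqr_sqrtr d0).
by rewrite ltr_pXn2r// nnegrE sqrtr_ge0.
Qed.

(** The ball of radius a whose sphere passes through q with outward normal nu.
    In this form the condition is a quadratic expression in u - q without a
    constant term, so that it can be added over several points and compared for
    several radii. *)
Lemma eball_tangent u q nu a : 0 <= a -> dotp nu nu = 1 ->
  eball (q - a *: nu) a u <->
  dotp (u - q) (u - q) + 2 * a * dotp (u - q) nu < 0.
Proof.
move=> a0 nu1; rewrite eball_sqr// [u - _](_ : _ = (u - q) + a *: nu); last first.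
  by rewrite opprB addrCA addrC -addrA addrC.
move: (u - q) => w; rewrite !dotpE nu1 (dotpC nu).
by split; lra.
Qed.

End Dotp.

(** * Locally supporting balls and convexity *)

Section LocalSupport.
Context {R : realType} {N : nat}.
Implicit Types (Omega : set 'rV[R]_N) (q nu x y z u v w : 'rV[R]_N) (r : R).

(** By eball_tangent, near q the closure of Omega minus q lies in the open ball
    of radius r with centre q - r nu. *)
Definition locally_in_ball Omega q nu r : Prop :=
  \forall z \near q, closure Omega z -> z != q ->
    dotp (z - q) (z - q) + 2 * r * dotp (z - q) nu < 0.

Definition ball_supported Omega r : Prop :=
  forall q, boundary Omega q ->
    exists2 nu, dotp nu nu = 1 & locally_in_ball Omega q nu r.

Definition segment_closed Omega : Prop :=
  forall x y t, Omega x -> Omega y -> 0 <= t <= 1 -> Omega (x + t *: (y - x)).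

Lemma open_boundary Omega z :
  open Omega -> closure Omega z -> ~ Omega z -> boundary Omega z.
Proof. by move=> oO cz nz; split=> //; rewrite ((interior_id Omega).1 oO). Qed.

Lemma closure_cvg {S : Type} {F : set_system S} {FF : ProperFilter F}
    (A : set 'rV[R]_N) (f : S -> 'rV[R]_N) z :
  f @ F --> z -> (\forall s \near F, A (f s)) -> closure A z.
Proof.
move=> fz fA B /fz fB.
have [s [As Bs]] := filter_ex (filterI fA fB).
by exists (f s).
Qed.

Lemma cvg_line q v : q + t *: v @[t --> (0 : R)^'+] --> q.
Proof.
rewrite -[X in _ --> X]addr0 -(scale0r v).
apply: cvgD; first exact: cvg_cst.
by apply: cvgZr_tmp; exact: cvg_within.
Qed.

(** The contradiction behind every touching argument: the supporting conditions
    of two points of the closure, taken on either side of q, have a negative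
    sum. *)
Lemma locally_in_ball_pair {S : Type} {F : set_system S} {FF : ProperFilter F}
    Omega q nu r (f g : S -> 'rV[R]_N) :
  locally_in_ball Omega q nu r -> f @ F --> q -> g @ F --> q ->
  (\forall s \near F, [/\ closure Omega (f s), f s != q,
      closure Omega (g s), g s != q &
      0 <= dotp (f s - q) (f s - q) + dotp (g s - q) (g s - q) +
           2 * r * dotp ((f s - q) + (g s - q)) nu]) ->
  False.
Proof.
move=> loc fq gq cl.
pose P := [set z | closure Omega z -> z != q ->
  dotp (z - q) (z - q) + 2 * r * dotp (z - q) nu < 0].
have Pf : F (f @^-1` P) := fq _ loc.
have Pg : F (g @^-1` P) := gq _ loc.
have [s [[cf nf cg ng +] [/= hf hg]]] := filter_ex (filterI cl (filterI Pf Pg)).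
move: (hf cf nf) (hg cg ng); move: (f s - q) (g s - q) => u v.
rewrite dotpDl; lra.
Qed.

(** For a fixed x, the points y whose segment to x stays in Omega form a
    nonempty subset of Omega that is open, by compactness of the segment, and
    closed in Omega: a limit segment lies in the closure of Omega, and if it met
    the boundary at q, the points q + k (y - x) and q - k (y - x) would both be
    in the supporting ball, whose conditions add up to 2 k^2 |y - x|^2. *)
Lemma segment_closed_of_supported Omega r :
  open Omega -> connected Omega -> ball_supported Omega r -> segment_closed Omega.
Proof.
move=> oO cO loc x y t Ox Oy t01.
pose S := [set y | Omega y /\ `[0, 1] `<=` [set t : R | Omega (x + t *: (y - x))]].
suff : S = Omega.
  move=> SO; have [_ Sy] : S y by rewrite SO.
  by apply: (Sy t); rewrite /= in_itv.
have Sx : S x by split => // s _ /=; rewrite subrr scaler0 addr0.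
have cont (s : R) y' : x + z.1 *: (z.2 - x) @[z --> (s, y')] --> x + s *: (y' - x).
  apply: cvgD; first exact: cvg_cst.
  apply: cvgZ; first exact: cvg_fst.
  by apply: cvgB; [exact: cvg_snd|exact: cvg_cst].
apply: cO; first by exists x.
- exists S; last by apply/seteqP; split => [z Sz|z []//]; split => //; case: Sz.
  rewrite openE => y' [Oy' Sy']; apply: filterI; first exact: open_nbhs_nbhs.
  have /compact_near_coveringP := @segment_compact _ (0 : R) 1.
  move=> /(_ _ (nbhs y') (fun z s => Omega (x + s *: (z - x))) _).
  apply => s /Sy' /= Os.
  have /cont : nbhs (x + s *: (y' - x)) Omega by exact: open_nbhs_nbhs.
  by [].
- exists (closure S); first exact: closed_closure.
  apply/seteqP; split => [z Sz|z [Oz clz]].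
    by split; [case: Sz|exact: subset_closure].
  split => // s; rewrite /= in_itv /= => s01.
  apply: contrapT => nO.
  have cl (a : R) : 0 <= a <= 1 -> closure Omega (x + a *: (z - x)).
    move=> a01 B /= hB.
    have /clz [y' [[_ Sy'] By']] : nbhs z [set y' | B (x + a *: (y' - x))].
      have /(_ _ hB) := cont a z.
      case=> -[/= U V] [Ua Vz] UV; apply: filterS Vz => y' Vy'.
      by apply: (UV (a, y')); split => //=; exact: nbhs_singleton.
    by exists (x + a *: (y' - x)); split => //; apply: Sy'; rewrite /= in_itv.
  have [nu _ hnu] := loc _ (open_boundary oO (cl _ s01) nO).
  have zx : z - x != 0.
    by apply/eqP => zx; apply: nO; rewrite zx scaler0 addr0.
  have s0 : 0 < s.
    rewrite lt0r; case/andP: s01 => -> _; rewrite andbT.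
    by apply/eqP => s0; apply: nO; rewrite s0 scale0r addr0.
  have s1 : s < 1.
    rewrite lt_neqAle; case/andP: s01 => _ ->; rewrite andbT.
    by apply/eqP => s1; apply: nO; rewrite s1 scale1r addrC subrK.
  set q := x + s *: (z - x) in nO hnu.
  apply: (locally_in_ball_pair hnu (@cvg_line q (z - x)) (@cvg_line q (- (z - x)))).
  near=> k.
  have k0 : 0 < k by [].
  have ks : k < s by near: k; exact: nbhs_right_lt.
  have k1 : k < 1 - s by near: k; apply: nbhs_right_lt; rewrite subr_gt0.
  split.
  - by rewrite -addrA -scalerDl; apply: cl; lra.
  - by rewrite -subr_eq0 addrAC subrr add0r scaler_eq0 negb_or zx gt_eqF.
  - by rewrite scalerN -addrA -scalerBl; apply: cl; lra.
  - by rewrite -subr_eq0 addrAC subrr add0r scaler_eq0 negb_or oppr_eq0 zx gt_eqF.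
  - rewrite ![q + _]addrC !addrK scalerN subrr; move: (k *: _) => v.
    have := dotp_ge0 v; rewrite -(scale0r v) !dotpE; lra.
Unshelve. all: by end_near. Qed.

End LocalSupport.

(** * Circular arcs between two points *)

Section Arcs.
Context {R : realType} {N : nat}.
Implicit Types (Omega : set 'rV[R]_N) (q nu x y z u v w : 'rV[R]_N) (r : R).

Lemma cvg_rot : (2 * k / (1 + k ^+ 2) : R) @[k --> (0 : R)^'+] --> (0 : R).
Proof.
apply: cvg_at_right_filter.
suff : (2 * k / (1 + k ^+ 2) : R) @[k --> (0 : R)] --> (2 * 0 / (1 + 0 ^+ 2) : R).
  by rewrite mulr0 mul0r.
apply: cvgM; first by apply: cvgM; [exact: cvg_cst|exact: cvg_id].
apply: cvgV; first by rewrite expr0n addr0 oner_neq0.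
by apply: cvgD; [exact: cvg_cst|exact: exprn_continuous].
Qed.

Lemma cvg_pair_point {S : Type} {F : set_system S} {FF : Filter F}
    (f g : S -> R) (a b : R) (x e n : 'rV[R]_N) :
  f @ F --> a -> g @ F --> b ->
  x + f s *: e + g s *: n @[s --> F] --> x + a *: e + b *: n.
Proof.
move=> fa gb; apply: cvgD; last by apply: cvgZ=> //; exact: cvg_cst.
by apply: cvgD; [exact: cvg_cst|apply: cvgZ => //; exact: cvg_cst].
Qed.

(** In the plane through x spanned by the orthonormal vectors e and n, let s and
    b be the coordinates along e and n.  The circle with centre s = L / 2,
    b = - h passes through x and x + L e, has squared radius h^2 + L^2 / 4 >= r^2,
    and its disc is b^2 + 2 h b <= s (L - s); the region considered is the part
    of this disc with b >= 0.

    A point (s, b) with b > 0 lies on exactly one circle through x and x + L e,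
    the one with h = (s (L - s) - b^2) / (2 b).  If the region is not contained
    in Omega, choose in it a point q outside Omega with h maximal, say h = h1:
    this is the first touching point when the segment is bent into arcs of
    decreasing radius.  The points with b > 0 strictly below the arc through q are
    in Omega, so the arc itself is in the closure of Omega, and the two points obtained by
    turning q by opposite angles about the centre contradict the support at
    q. *)
Lemma arc_region_sub Omega r (h : R) x e n (L : R) :
  open Omega -> segment_closed Omega -> ball_supported Omega r ->
  0 < r -> 0 <= h -> 0 < L -> Omega x -> Omega (x + L *: e) ->
  dotp e e = 1 -> dotp n n = 1 -> dotp e n = 0 ->
  r ^+ 2 <= h ^+ 2 + L ^+ 2 / 4 ->
  forall s b, 0 <= b -> b ^+ 2 + 2 * h * b <= s * (L - s) ->
  Omega (x + s *: e + b *: n).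
Proof.
move=> oO sO loc r0 h0 L0 Ox Oy ee nn en hr s b b0 sb; apply: contrapT => nO.
pose P (p : R * R) := x + p.1 *: e + p.2 *: n.
have cP (p : R * R) : P q @[q --> p] --> P p.
  by apply: cvg_pair_point; [exact: cvg_fst|exact: cvg_snd].
pose T := [set p : R * R | [/\ 0 <= p.2, p.2 ^+ 2 + 2 * h * p.2 <= p.1 * (L - p.1) &
   ~ Omega (P p)]].
have sLs a c : 0 <= c -> c ^+ 2 + 2 * h * c <= a * (L - a) -> 0 <= a <= L.
  move=> c0 ac; have : 0 <= a * (L - a) by nra.
  by move=> ?; apply/andP; split; nra.
(* Points with b = 0 are on the segment, hence in Omega. *)
have T0 p : T p -> 0 < p.2.
  move=> [p0 ph pO]; rewrite lt0r p0 andbT; apply/eqP => p20; apply: pO.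
  have := sLs _ _ p0 ph; rewrite /P p20 scale0r addr0 => p1.
  have : 0 <= p.1 / L <= 1.
    case/andP: p1 => ? ?; apply/andP; split; last by rewrite ler_pdivrMr// mul1r.
    by apply: divr_ge0 => //; exact: ltW.
  move=> /(sO _ _ _ Ox Oy).
  by rewrite (addrAC x) subrr add0r scalerA divfK ?gt_eqF.
have Tcompact : compact T.
  apply: (@subclosed_compact _ _ (`[0, L] `*` `[0, L])); last 2 first.
  - by apply: compact_setX; exact: segment_compact.
  - move=> p [p0 ph _]; have /andP[? ?] := sLs _ _ p0 ph.
    rewrite /= !in_itv /=; split; apply/andP; split => //; nra.
  have -> : T = [set p : R * R | 0 <= p.2] `&`
      [set p | 0 <= p.1 * (L - p.1) - (p.2 ^+ 2 + 2 * h * p.2)] `&` P @^-1` (~` Omega).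
    by apply/seteqP; split => [p [? ? ?]|p [[/= ? ?] ?]]; split => //=;
      rewrite ?subr_ge0 // -subr_ge0.
  apply: closedI; last by apply: closed_comp => [p _|]; [exact: cP|exact: open_closedC].
  apply: closedI.
    by apply: (closed_comp _ (@closed_ge R 0)) => p _; exact: cvg_snd.
  apply: (closed_comp _ (@closed_ge R 0)) => p _.
  apply: cvgB.
    by apply: cvgM; [exact: cvg_fst|apply: cvgB; [exact: cvg_cst|exact: cvg_fst]].
  apply: cvgD; last by apply: cvgM; [exact: cvg_cst|exact: cvg_snd].
  by rewrite expr2; apply: cvgM; exact: cvg_snd.
pose phi (p : R * R) := (p.1 * (L - p.1) - p.2 ^+ 2) / (2 * p.2).
have [] := @compact_EVT_max _ _ phi T _ Tcompact.
  by exists (s, b); split.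
  apply: continuous_in_subspaceT => p /set_mem/T0 p0.
  apply: cvgM.
    apply: cvgB; last by rewrite expr2; apply: cvgM; exact: cvg_snd.
    by apply: cvgM; [exact: cvg_fst|apply: cvgB; [exact: cvg_cst|exact: cvg_fst]].
  apply: cvgV; first by rewrite mulf_neq0// gt_eqF.
  by apply: cvgM; [exact: cvg_cst|exact: cvg_snd].
move=> [s1 b1] /set_mem Tq qmax.
have := T0 _ Tq; rewrite /= => b1_gt0.
set h1 := phi (s1, b1) in qmax.
have h1E : b1 ^+ 2 + 2 * h1 * b1 = s1 * (L - s1).
  by rewrite /h1 /phi /=; field; rewrite gt_eqF.
have hh1 : h <= h1.
  by case: Tq => _ /= + _; nra.
clearbody h1.
have h10 : 0 <= h1 by exact: le_trans hh1.
have inO a c : 0 < c -> c ^+ 2 + 2 * h1 * c < a * (L - a) -> Omega (P (a, c)).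
  move=> c0 ac; apply: contrapT => nOac.
  have /mem_set/qmax : T (a, c) by split => //=; nra.
  rewrite /phi /= ler_pdivrMr ?mulr_gt0//; nra.
have clO a c : 0 < c -> c ^+ 2 + 2 * h1 * c <= a * (L - a) -> closure Omega (P (a, c)).
  move=> c0 ac; apply: (closure_cvg (@cvg_line _ _ (P (a, c)) (- n))).
  near=> k.
  have k0 : 0 < k by [].
  have kc : k < c by near: k; exact: nbhs_right_lt.
  have -> : P (a, c) + k *: - n = P (a, c - k).
    by rewrite /P /= scalerN scalerBl addrA.
  by apply: inO; nra.
pose q := P (s1, b1).
have nOq : ~ Omega q by case: Tq.
have clq : closure Omega q by apply: clO => //; rewrite h1E.
have [nu nu1 loc_q] := loc q (open_boundary oO clq nOq).
(* Coordinates relative to the centre: q is the centre plus A, and J is A turned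
   by a right angle. *)
pose a := s1 - L / 2; pose c := b1 + h1.
pose A : 'rV[R]_N := a *: e + c *: n.
pose J : 'rV[R]_N := - c *: e + a *: n.
pose rho2 := a ^+ 2 + c ^+ 2.
have ne : dotp n e = 0 by rewrite dotpC.
have AA : dotp A A = rho2 by rewrite !dotpE ee nn en ne /rho2; ring.
have JJ : dotp J J = rho2 by rewrite !dotpE ee nn en ne /rho2; ring.
have AJ : dotp A J = 0 by rewrite !dotpE ee nn en ne; ring.
have JA : dotp J A = 0 by rewrite dotpC.
have rho2E : rho2 = h1 ^+ 2 + L ^+ 2 / 4 by rewrite /rho2 /a /c; lra.
have rho2r : r ^+ 2 <= rho2 by rewrite rho2E; nra.
have rho20 : 0 < rho2 by apply: lt_le_trans rho2r; rewrite exprn_gt0.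
(* rho2 is the squared radius of the touching arc, so that |A| r <= rho2. *)
have rA : r * dotp A nu <= rho2.
  rewrite leNgt; apply/negP => lt.
  have : rho2 ^+ 2 < (r * dotp A nu) ^+ 2 by rewrite ltr_pXn2r// nnegrE; lra.
  have := cauchy_schwarz A nu; rewrite AA nu1 mulr1 exprMn; nra.
(* Rational parametrisation of the circle: turning A by the angle 2 arctan k adds
   m k (J - k A) to it, and turning it the other way adds m k (- J - k A). *)
pose m k : R := 2 * k / (1 + k ^+ 2).
have mk k : m k * (1 + k ^+ 2) = 2 * k.
  by rewrite /m; field; apply: lt0r_neq0; nra.
have cvg_arc (sg : R) : q + m k *: (sg *: J - k *: A) @[k --> (0 : R)^'+] --> q.
  rewrite -[X in _ --> X]addr0 -(scale0r (sg *: J - 0 *: A)).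
  apply: cvgD; first exact: cvg_cst.
  apply: cvgZ; first exact: cvg_rot.
  apply: cvgB; first exact: cvg_cst.
  by apply: cvgZr_tmp; exact: cvg_within.
have arcP (sg k : R) : q + m k *: (sg *: J - k *: A) =
    P (s1 + m k * (- sg * c - k * a), b1 + m k * (sg * a - k * c)).
  rewrite /q /P /J /A /=; apply/rowP => i; rewrite !mxE; ring.
clearbody A J.
have arc_cl (sg : R) : sg ^+ 2 = 1 ->
    \forall k \near (0 : R)^'+, closure Omega (q + m k *: (sg *: J - k *: A)) /\
      q + m k *: (sg *: J - k *: A) != q.
  move=> sg1; have cb : b1 + m k * (sg * a - k * c) @[k --> (0 : R)^'+] --> b1.
    rewrite -[X in _ --> X]addr0 -[X in _ + X](mul0r (sg * a - 0 * c)).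
    apply: cvgD; first exact: cvg_cst.
    apply: cvgM; first exact: cvg_rot.
    apply: cvgB; first exact: cvg_cst.
    by apply: cvgM; [exact: cvg_within|exact: cvg_cst].
  near=> k.
  have k0 : 0 < k by [].
  have m0 : 0 < m k by rewrite divr_gt0//; nra.
  have mE := mk k.
  split.
    rewrite arcP; apply: clO; first by near: k; exact: (cvgr_gt b1).
    rewrite -subr_ge0 le_eqVlt; apply/orP; left; apply/eqP.
    set M := m k in mE *.
    transitivity (s1 * (L - s1) - (b1 ^+ 2 + 2 * h1 * b1) +
                  M * rho2 * (2 * k - M * (sg ^+ 2 + k ^+ 2))).
      by rewrite sg1 mE h1E !subrr mulr0 addr0.
    by rewrite /rho2 /a /c; field.
  rewrite -subr_eq0 addrAC subrr add0r scaler_eq0 (gt_eqF m0)/= -dotp_eq0.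
  rewrite !dotpE AA JJ AJ JA; apply: lt0r_neq0.
  by rewrite (_ : _ + _ = rho2 * (sg ^+ 2 + k ^+ 2)); [rewrite sg1; nra|ring].
apply: (locally_in_ball_pair loc_q (cvg_arc 1) (cvg_arc (-1))).
near=> k.
have [f1 f2] : closure Omega (q + m k *: (1 *: J - k *: A)) /\
    q + m k *: (1 *: J - k *: A) != q.
  by near: k; apply: arc_cl; rewrite expr1n.
have [g1 g2] : closure Omega (q + m k *: (-1 *: J - k *: A)) /\
    q + m k *: (-1 *: J - k *: A) != q.
  by near: k; apply: arc_cl; rewrite sqrrN expr1n.
split => //.
have k0 : 0 < k by [].
have m0 : 0 < m k by rewrite divr_gt0//; nra.
have mE := mk k.
rewrite ![q + _]addrC !addrK; set M := m k in mE m0 *.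
rewrite !dotpE AA JJ AJ JA.
rewrite [leRHS](_ : _ = 2 * M * (M * (1 + k ^+ 2)) * rho2 -
  4 * M * k * (r * dotp A nu)); last by ring.
rewrite mE.
have Mk0 : 0 < M * k by rewrite mulr_gt0.
nra.
Unshelve. all: by end_near. Qed.

End Arcs.

(** * From local to global support *)

Section Global.
Context {R : realType} {N : nat}.
Implicit Types (Omega : set 'rV[R]_N) (p q nu x y z u v w : 'rV[R]_N) (r : R).

Lemma exists_unit_orthogonal nu : (2 <= N)%N ->
  exists2 w, dotp w w = 1 & dotp w nu = 0.
Proof.
move=> N2; have : kermx nu^T != 0.
  rewrite -mxrank_eq0 mxrank_ker subn_eq0 -ltnNge.
  by rewrite (leq_ltn_trans (rank_leq_col _)).
case/rowV0Pn => w /sub_kermxP w_nu w0.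
have ww : 0 < dotp w w by rewrite dotp_gt0.
have wnu : dotp w nu = 0.
  have := congr1 (fun M : 'M[R]_1 => M 0 0) w_nu; rewrite !mxE => <-.
  by apply: eq_bigr => i _; rewrite mxE.
exists ((Num.sqrt (dotp w w))^-1 *: w); rewrite !dotpE ?wnu ?mulr0//.
rewrite mulrA -invfM -expr2 sqr_sqrtr ?mulVf ?gt_eqF//; exact: ltW.
Qed.

Lemma cvg_translate p a : p' - p + a @[p' --> nbhs p] --> a.
Proof.
suff : p' - p + a @[p' --> nbhs p] --> p - p + a by rewrite subrr add0r.
apply: cvgD; last exact: cvg_cst.
by apply: cvgB; [exact: cvg_id|exact: cvg_cst].
Qed.

(** Suppose that y in Omega is not in the ball touching the boundary at p.  Let
    L e = y - p, with e a unit vector, and let - c be the cosine of the angle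
    between e and nu; then 2 r c < L.  Let n complete e to an orthonormal basis
    of the plane of e and nu, with nu = - c e + sg n.  Because of
    2 r c < L there is an h with h^2 + L^2 / 4 >= r^2 and, if c > 0, with
    h c < (L / 2) sg.  Then the direction e + th n, where th = c / sg (or 0 if
    c <= 0), points into the region below the arc from p to y, while the points
    p + s (e + th n) are not in the ball.  For small s they are in the closure of
    Omega, because p is a limit of points p' of Omega to which arc_region_sub
    applies with endpoint y + (p' - p). *)
Lemma sub_tangent_ball Omega p nu r y :
  (2 <= N)%N -> open Omega -> segment_closed Omega -> ball_supported Omega r ->
  0 < r -> boundary Omega p -> dotp nu nu = 1 -> locally_in_ball Omega p nu r ->
  Omega y -> dotp (y - p) (y - p) + 2 * r * dotp (y - p) nu < 0.
Proof.
move=> N2 oO sO loc r0 [clp _] nu1 loc_p Oy; rewrite ltNge; apply/negP => hy.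
have [w ww wnu] := exists_unit_orthogonal nu N2.
have nuw : dotp nu w = 0 by rewrite dotpC.
(* Moving y slightly along w, away from the line through p with direction nu,
   makes the assumption strict and y - p not parallel to nu. *)
have [y' [Oy' hy' yw']] : exists y', [/\ Omega y',
    0 < dotp (y' - p) (y' - p) + 2 * r * dotp (y' - p) nu & dotp (y' - p) w != 0].
  have Oline v : \forall t \near (0 : R)^'+, Omega (y + t *: v).
    by apply: (@cvg_line _ _ y v); exact: open_nbhs_nbhs.
  near (0 : R)^'+ => t.
  have t0 : 0 < t by [].
  have [yw|yw] := lerP 0 (dotp (y - p) w).
  - exists (y + t *: w); split; first by near: t.
      rewrite addrAC; move: (y - p) yw hy => v yw hy.
      have t2 : 0 < t * t by rewrite mulr_gt0.
      have tv : 0 <= t * `|dotp v w| by rewrite mulr_ge0// ltW.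
      by rewrite !dotpE (dotpC w v) ww wnu; rewrite ger0_norm// in tv; lra.
    rewrite addrAC; move: (y - p) yw => v yw.
    by rewrite !dotpE ww; apply: lt0r_neq0; lra.
  - exists (y + t *: - w); split; first by near: t.
      rewrite addrAC; move: (y - p) yw hy => v yw hy.
      have t2 : 0 < t * t by rewrite mulr_gt0.
      have tv : 0 <= t * `|dotp v w| by rewrite mulr_ge0// ltW.
      by rewrite !dotpE (dotpC w v) ww wnu; rewrite ltr0_norm// in tv; lra.
    rewrite addrAC; move: (y - p) yw => v yw.
    by rewrite !dotpE ww; apply: ltr0_neq0; lra.
move: y' Oy' hy' yw' => {hy Oy}y Oy hy yw.
set D := y - p in hy yw.
have yE : y = D + p by rewrite subrK.
clearbody D.
have D0 : D != 0 by apply: contraNneq yw => ->; rewrite -(scale0r 0) dotpZl mul0r.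
have DD0 : 0 < dotp D D by rewrite dotp_gt0.
pose L := Num.sqrt (dotp D D).
have L0 : 0 < L by rewrite sqrtr_gt0.
have L2 : L ^+ 2 = dotp D D by rewrite sqr_sqrtr// ltW.
pose e := L^-1 *: D.
have DE : D = L *: e by rewrite /e scalerA divff ?scale1r ?gt_eqF.
have ee : dotp e e = 1 by rewrite /e !dotpE -L2; field; rewrite gt_eqF.
clearbody e; clearbody L.
pose c := - dotp e nu.
have enu : dotp e nu = - c by rewrite opprK.
have nue : dotp nu e = - c by rewrite dotpC.
have ew : dotp e w != 0 by move: yw; rewrite DE dotpZl mulf_eq0 negb_or => /andP[].
have c2 : c ^+ 2 < 1.
  (* Bessel's inequality for the orthonormal vectors nu and w. *)
  have := dotp_ge0 (e - dotp e nu *: nu - dotp e w *: w).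
  rewrite !dotpE (dotpC w e) ee nu1 ww wnu nuw nue enu.
  have : 0 < dotp e w ^+ 2 by rewrite exprn_even_gt0.
  nra.
have Lc : 2 * r * c < L.
  by move: hy; rewrite DE !dotpE ee enu; nra.
pose sg := Num.sqrt (1 - c ^+ 2).
have sg0 : 0 < sg by rewrite sqrtr_gt0 subr_gt0.
have sg2 : sg ^+ 2 = 1 - c ^+ 2 by rewrite sqr_sqrtr// subr_ge0 ltW.
clearbody sg.
pose n := sg^-1 *: (nu + c *: e).
have en : dotp e n = 0 by rewrite /n !dotpE ee enu; ring.
have nn : dotp n n = 1.
  rewrite /n !dotpE ee enu nue nu1; apply: (@mulfI _ (sg ^+ 2)).
    by rewrite sg2; nra.
  by rewrite mulr1 [in RHS]sg2; field; rewrite gt_eqF.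
have nnu : dotp n nu = sg.
  rewrite /n !dotpE nu1 enu; apply: (@mulfI _ sg); first by rewrite gt_eqF.
  by rewrite mulrA divff ?gt_eqF// -expr2 sg2; ring.
clearbody n.
(* A half-circle if the chord has length at least 2 r, else radius exactly r. *)
have [h [h0 hr hc]] : exists h : R, [/\ 0 <= h, r ^+ 2 <= h ^+ 2 + L ^+ 2 / 4 &
    0 < c -> h * c < L / 2 * sg].
  have [rL|Lr] := lerP r (L / 2).
    have rL2 : 0 <= (L / 2 - r) * (L / 2 + r) by rewrite mulr_ge0//; lra.
    exists 0; split => //; first by lra.
    by rewrite mul0r => _; rewrite mulr_gt0// divr_gt0.
  have rL2 : 0 <= r ^+ 2 - L ^+ 2 / 4.
    have : 0 <= (r - L / 2) * (r + L / 2) by rewrite mulr_ge0//; lra.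
    lra.
  exists (Num.sqrt (r ^+ 2 - L ^+ 2 / 4)); split; first exact: sqrtr_ge0.
    by rewrite sqr_sqrtr// subrK.
  move=> c0; rewrite -(@ltr_pXn2r _ 2)// ?nnegrE ?mulr_ge0 ?sqrtr_ge0 ?(ltW c0)
    ?(ltW sg0)//; last by lra.
  have rc0 : 0 < r * c by rewrite mulr_gt0.
  have : 0 < (L / 2 - r * c) * (L / 2 + r * c) by rewrite mulr_gt0//; lra.
  rewrite !exprMn sqr_sqrtr// sg2; lra.
pose th := if 0 < c then c / sg else 0.
have [th0 hth csg] : [/\ 0 <= th, h * th < L / 2 & c <= th * sg].
  rewrite /th; case: ltrP => c0; last by split; lra.
  split; first by rewrite divr_ge0// ltW.
    by rewrite mulrA ltr_pdivrMr// hc.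
  by rewrite divfK ?gt_eqF.
clearbody th.
have clz s : 0 < s -> th ^+ 2 * s + 2 * h * th <= L - s ->
    closure Omega (p + s *: (e + th *: n)).
  move=> s0 hs; set z := p + _.
  move=> B Bz.
  have /clp [p' [Op' [Bp' Oyp']]] :
      nbhs p ([set p' | B (p' - p + z)] `&` [set p' | Omega (p' - p + y)]).
    apply: filterI; first exact: (@cvg_translate p z B Bz).
    by apply: (@cvg_translate p y Omega); exact: open_nbhs_nbhs.
  exists (p' - p + z); split => //.
  have -> : p' - p + z = p' + s *: e + (th * s) *: n.
    by rewrite /z scalerDr scalerA (mulrC s) !addrA subrK.
  apply: (@arc_region_sub _ _ _ r h _ _ _ L) => //; first 1 last.
  - by rewrite mulr_ge0// ltW.
  - nra.
  - by move: Oyp'; rewrite /= -DE yE addrA addrAC subrK addrC.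
have th2 : 0 < th ^+ 2 + 1 by rewrite ltr_wpDl ?sqr_ge0.
have bound0 : 0 < (L / 2 - h * th) * 2 / (th ^+ 2 + 1).
  by rewrite divr_gt0// mulr_gt0// subr_gt0.
have s_ev : \forall s \near (0 : R)^'+, [/\ closure Omega (p + s *: (e + th *: n)),
      p + s *: (e + th *: n) != p &
      0 <= dotp (p + s *: (e + th *: n) - p) (p + s *: (e + th *: n) - p)
           + 2 * r * dotp (p + s *: (e + th *: n) - p) nu].
  near=> s.
  have s0 : 0 < s by [].
  have u0 : dotp (e + th *: n) (e + th *: n) = 1 + th ^+ 2.
    by rewrite !dotpE ee nn en (dotpC n) en; ring.
  rewrite -subr_eq0 (addrAC p) subrr add0r; split.
  - apply: clz => //.
    have : s < (L / 2 - h * th) * 2 / (th ^+ 2 + 1).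
      by near: s; apply: nbhs_right_lt.
    by rewrite ltr_pdivlMr// => hs; clear -hs s0; lra.
  - by rewrite scaler_eq0 gt_eqF//= -dotp_eq0 u0 (addrC 1) lt0r_neq0.
  - rewrite dotpZl dotpZr u0 dotpZl dotpDl dotpZl enu nnu.
    have csg0 : 0 <= - c + th * sg by rewrite addrC subr_ge0.
    have s2 : 0 <= s * (s * (1 + th ^+ 2)).
      by rewrite (addrC 1) !mulr_ge0 ?(ltW s0) ?(ltW th2).
    by rewrite addr_ge0// mulr_ge0 ?mulr_ge0 ?(ltW s0) ?(ltW r0).
have /(_ _ loc_p) hloc := @cvg_line _ _ p (e + th *: n).
have [s [[s1 s2 s3] /= s4]] := filter_ex (filterI s_ev hloc).
by move: s3; rewrite leNgt s4.
Unshelve. all: by end_near. Qed.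

End Global.

(** * Intersections of balls *)

Section Intersection.
Context {R : realType} {N : nat}.
Implicit Types (Omega : set 'rV[R]_N) (p q nu x y z u v w c : 'rV[R]_N) (r : R).

Lemma eball_convex c r x y (t : R) : 0 <= r -> 0 <= t <= 1 ->
  eball c r x -> eball c r y -> eball c r (x + t *: (y - x)).
Proof.
move=> r0 t01; rewrite !eball_sqr//.
have -> : x + t *: (y - x) - c = (1 - t) *: (x - c) + t *: (y - c).
  by apply/rowP => i; rewrite !mxE; ring.
move: (x - c) (y - c) => {x y}x y xr yr.
have xy := dotp_ge0 (x - y).
move: xy; rewrite !dotpE (dotpC y x) => xy.
have [t0 t1] : 0 <= t /\ 0 <= 1 - t by lra.
have : 0 <= (t * (1 - t)) * (dotp x x - dotp x y + (- dotp x y - - dotp y y)).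
  by rewrite mulr_ge0// mulr_ge0.
have : 0 < (1 - t) * (r ^+ 2 - dotp x x) + t * (r ^+ 2 - dotp y y).
  have [->|tn0] := eqVneq t 0; first by lra.
  apply: ltr_wpDl; first by rewrite mulr_ge0//; lra.
  by apply: mulr_gt0; [rewrite lt0r tn0|rewrite subr_gt0].
lra.
Qed.

(** The boundary point is the first one at which the segment is outside Omega. *)
Lemma exit_point Omega x z : open Omega -> Omega x -> ~ Omega z ->
  exists2 t : R, 0 <= t <= 1 & boundary Omega (x + t *: (z - x)).
Proof.
move=> oO Ox nOz.
pose P (t : R) := x + t *: (z - x).
have cP (t : R) : P s @[s --> t] --> P t.
  by apply: cvgD; [exact: cvg_cst|apply: cvgZr_tmp; exact: cvg_id].
pose A := `[0, 1]%classic `&` P @^-1` (~` Omega).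
have Acompact : compact A.
  apply: compact_closedI; first exact: segment_compact.
  by apply: closed_comp => [t _|]; [exact: cP|exact: open_closedC].
have [] := @compact_EVT_min _ _ (id : R -> R) A _ Acompact.
- exists 1; split; first by rewrite /= in_itv /= lexx ler01.
  by rewrite /= /P scale1r addrC subrK.
- by apply: continuous_subspaceT => t; exact: cvg_id.
move=> t /set_mem[]; rewrite /= in_itv /= => t01 nOt tmin; exists t => //.
apply: open_boundary => //.
have t0 : 0 < t.
  rewrite lt0r; case/andP: t01 => -> _; rewrite andbT; apply/eqP => t0.
  by apply: nOt; rewrite /P t0 scale0r addr0.
apply: (closure_cvg (@cvg_line _ _ (P t) (- (z - x)))); near=> k.
rewrite scalerN -addrA -scalerBl.
apply: contrapT => nO.
have k0 : 0 < k by [].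
have kt : k < t by near: k; exact: nbhs_right_lt.
have /tmin : t - k \in A.
  by apply/mem_set; split => //; rewrite /= in_itv /=; lra.
by rewrite /=; lra.
Unshelve. all: by end_near. Qed.

(** At a boundary point p, sub_tangent_ball applies with the same normal for every
    radius r' > rho.  Letting r' decrease to r shows that Omega lies in the closed
    ball of radius r touching at p, hence, being open, in the open one.  Omega is
    the intersection of all balls of radius r that contain it: on the segment from
    a point of Omega to a point z outside, let p be a boundary point; a ball
    around Omega touching it at p contains the first point but not p, so by
    convexity it does not contain z. *)
Lemma class_C_of_local_support Omega rho r :
  (2 <= N)%N -> domain Omega -> bounded_set Omega -> 0 < rho -> rho <= r ->
  (forall q, boundary Omega q -> exists2 nu, dotp nu nu = 1 &
     forall r', rho < r' -> locally_in_ball Omega q nu r') ->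
  class_C r Omega.
Proof.
move=> N2 dO bO rho0 rho_r loc; split => //; case: dO => -[x0 Ox0] oO cO.
have r0 : 0 < r by exact: lt_le_trans rho_r.
have loc' r' : rho < r' -> ball_supported Omega r'.
  by move=> rr' q /loc[nu nu1 h]; exists nu => //; exact: h.
have sO : segment_closed Omega.
  by apply: (segment_closed_of_supported oO cO (loc' (rho + 1) _)); rewrite ltrDl.
have in_ball p : boundary Omega p ->
    exists c, Omega `<=` eball c r /\ dotp (p - c) (p - c) = r ^+ 2.
  move=> bp; have [nu nu1 loc_p] := loc _ bp.
  have nOp : ~ Omega p by case: bp => _; rewrite ((interior_id Omega).1 oO).
  have le y : Omega y -> dotp (y - p) (y - p) + 2 * r * dotp (y - p) nu <= 0.
    move=> Oy; rewrite leNgt; apply/negP => gt0.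
    set A := dotp (y - p) (y - p) in gt0; set B := dotp (y - p) nu in gt0.
    have lt r' : rho < r' -> A + 2 * r' * B < 0.
      move=> rr'; apply: (@sub_tangent_ball _ _ Omega p nu r') => //.
      - exact: loc'.
      - exact: lt_trans rr'.
      - exact: loc_p.
    have [B0|B0] := lerP 0 B.
      by have := lt (r + 1); rewrite (le_lt_trans rho_r) ?ltrDl// => /(_ isT); lra.
    (* With this radius the left-hand side of lt is half of its value at r. *)
    have := lt (r + (A + 2 * r * B) / (- 4 * B)).
    rewrite (le_lt_trans rho_r) ?ltrDl ?divr_gt0//; last by lra.
    move=> /(_ isT).
    rewrite (_ : _ + _ = (A + 2 * r * B) / 2); first by lra.
    by field; rewrite lt_eqF.
  exists (p - r *: nu); split; last first.
    by rewrite opprB addrCA subrr addr0 !dotpE nu1; ring.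
  (* A point of Omega on the sphere could be moved outwards within Omega. *)
  move=> y Oy; rewrite eball_tangent ?(ltW r0)// lt_neqAle le// andbT.
  apply/eqP => eq0.
  have : \forall t \near (0 : R)^'+, Omega (y + t *: (y - p + r *: nu)).
    by apply: (@cvg_line _ _ y _); exact: open_nbhs_nbhs.
  move=> Oline; near (0 : R)^'+ => t.
  have t0 : 0 < t by [].
  have /le : Omega (y + t *: (y - p + r *: nu)) by near: t.
  have : y - p != 0 by apply: contra_notN nOp; rewrite subr_eq0 => /eqP <-.
  rewrite -dotp_gt0 (addrAC y); move: (y - p) eq0 => u eq0 u0.
  rewrite !dotpE (dotpC nu u) nu1.
  have : 0 < t * r ^+ 2 by rewrite mulr_gt0// exprn_gt0.
  have : 0 < t ^+ 2 * r ^+ 2 by rewrite mulr_gt0// exprn_gt0.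
  have -> : dotp u u = - (2 * r * dotp u nu) by lra.
  lra.
exists [set c | Omega `<=` eball c r]; apply/seteqP; split => [x Ox c|z hz].
  exact.
apply: contrapT => nOz.
have [t t01 bp] := exit_point oO Ox0 nOz.
have [c [Oc pc]] := in_ball _ bp.
have := eball_convex (ltW r0) t01 (Oc _ Ox0) (hz c Oc).
by rewrite eball_sqr ?ltW// pc ltxx.
Unshelve. all: by end_near. Qed.

End Intersection.

(** * Second-order calculus *)

Section Calculus.
Context {R : realType}.

Lemma mvt_closed (f df : R -> R) (a b : R) : a <= b ->
  (forall x, a <= x <= b -> is_derive x 1 f (df x)) ->
  exists2 c, a <= c <= b & f b - f a = df c * (b - a).
Proof.
move=> ab fd; have [] := @MVT_segment R f df a b ab.
- by move=> x; rewrite in_itv /= => /andP[/ltW ? /ltW ?]; apply: fd; apply/andP.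
- apply: derivable_within_continuous => x; rewrite in_itv /= => /fd ?.
  exact: ex_derive.
- by move=> c; rewrite in_itv /=; exists c.
Qed.

(** Taylor's formula of order two, as a lower bound: the mean value theorem is
    applied to f minus its Taylor polynomial and then to df. *)
Lemma taylor2_ge (f df ddf : R -> R) (M : R) :
  (forall t : R, 0 <= t <= 1 -> is_derive t 1 f (df t)) ->
  (forall t : R, 0 <= t <= 1 -> is_derive t 1 df (ddf t)) ->
  (forall t : R, 0 <= t <= 1 -> M <= ddf t) ->
  f 0 + df 0 + M / 2 <= f 1.
Proof.
move=> fd dfd Mle.
pose F t := f t - (df 0 * t + M / 2 * t ^+ 2).
have [|c c01] := @mvt_closed F (fun t => df t - (df 0 + M * t)) 0 1 ler01.
  move=> x x01; have := fd x x01 => ?; rewrite /F.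
  apply: is_derive_eq.
  rewrite !scaler1 /GRing.scale /=; lra.
rewrite subr0 mulr1 /F => FE.
have [c0 c1] : 0 <= c /\ c <= 1 by lra.
have [x x0c|d d0c dE] := @mvt_closed df ddf 0 c c0.
  by apply: dfd; lra.
have Md : 0 <= (ddf d - M) * c by rewrite mulr_ge0// subr_ge0; apply: Mle; lra.
move: dE FE; rewrite subr0 => dE FE; lra.
Qed.

Section Directional.
Context {N : nat}.
Implicit Types (f g : 'rV[R]_N -> R) (x q v w h : 'rV[R]_N) (U : set 'rV[R]_N).

Lemma is_derive_line f x v (t : R) : differentiable f (x + t *: v) ->
  is_derive t 1 (fun s : R => f (x + s *: v)) ('D_v f (x + t *: v)).
Proof.
move=> df.
have E : (fun k : R => k^-1 *: (f (x + (k *: 1 + t) *: v) - f (x + t *: v))) =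
         (fun k : R => k^-1 *: (f (k *: v + (x + t *: v)) - f (x + t *: v))).
  by apply/funext => k; rewrite [k *: 1]mulr1 scalerDl addrCA.
have dv : derivable f (x + t *: v) v by exact: diff_derivable.
split; first by rewrite /derivable E.
by rewrite /derive E.
Qed.

Lemma derive_grad f x v : differentiable f x -> 'D_v f x = dotp (grad f x) v.
Proof.
move=> df; rewrite deriveE// [in LHS](row_sum_delta v) linear_sum.
by apply: eq_bigr => i _; rewrite linearZ /= mxE deriveE// mulrC.
Qed.

(** The second difference of g over a small parallelogram is a mixed second
    derivative at some point of it, by two applications of the mean value
    theorem. *)
Lemma second_difference g U q v w (k : R) : C2_on U g -> 0 <= k ->
  (forall s t, 0 <= s <= k -> 0 <= t <= k -> U (q + s *: v + t *: w)) ->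
  exists s t, [/\ 0 <= s <= k, 0 <= t <= k &
   g (q + k *: v + k *: w) - g (q + k *: v) - (g (q + k *: w) - g q) =
   k ^+ 2 * 'D_w ('D_v g) (q + s *: v + t *: w)].
Proof.
move=> [C1 C2] k0 Uq.
have kk : 0 <= k <= k by rewrite k0 lexx.
have k00 : 0 <= (0 : R) <= k by rewrite k0 lexx.
have [s s0|s s0 sE] := @mvt_closed (fun s => g (q + k *: w + s *: v) - g (q + s *: v))
   (fun s => 'D_v g (q + k *: w + s *: v) - 'D_v g (q + s *: v)) 0 k k0.
  have dg t : 0 <= t <= k -> differentiable g (q + t *: w + s *: v).
    by move=> t0; rewrite addrAC; have [] := C1 _ (Uq _ _ s0 t0).
  apply: is_deriveB; first by apply: is_derive_line; exact: dg.
  by apply: is_derive_line; have := dg _ k00; rewrite scale0r addr0.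
have [t t0|t t0 tE] := @mvt_closed (fun t => 'D_v g (q + s *: v + t *: w))
    (fun t => 'D_w ('D_v g) (q + s *: v + t *: w)) 0 k k0.
  apply: is_derive_line.
  by have [] := C2 v (q + s *: v + t *: w) (Uq _ _ s0 t0).
exists s, t; split => //.
move: tE sE; rewrite !scale0r !addr0 !subr0 => tE.
rewrite (addrAC q (k *: w) (s *: v)) tE (addrAC q (k *: v)) => ->.
by ring.
Qed.

Lemma parallelogram_nbhs q v w (A : set 'rV[R]_N) : nbhs q A ->
  \forall k \near (0 : R)^'+, forall s t, 0 <= s <= k -> 0 <= t <= k ->
     A (q + s *: v + t *: w).
Proof.
move=> qA.
have c2 : q + z.1 *: v + z.2 *: w @[z --> ((0 : R), (0 : R))] --> q.
  suff : q + z.1 *: v + z.2 *: w @[z --> ((0 : R), (0 : R))] --> q + (0 : R) *: v + (0 : R) *: w.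
    by rewrite !scale0r !addr0.
  apply: cvgD; last by apply: cvgZr_tmp; exact: cvg_snd.
  by apply: cvgD; [exact: cvg_cst|apply: cvgZr_tmp; exact: cvg_fst].
have [[/= B C] [B0 C0] BC] := c2 _ qA.
have /nbhs_ballP[d /= d0 dBC] : nbhs (0 : R) (B `&` C) by exact: filterI.
near=> k => s t s0 t0.
have kd : k < d by near: k; exact: nbhs_right_lt.
have inb (a : R) : 0 <= a <= k -> B a /\ C a.
  move=> a0; apply: dBC; rewrite /ball/= sub0r normrN ger0_norm; lra.
by apply: (BC (s, t)); split; [have [] := inb s s0|have [] := inb t t0].
Unshelve. all: by end_near. Qed.

(** The second difference is symmetric in v and w, so that over arbitrarily small
    parallelograms the two mixed derivatives take a common value, at points that
    tend to q. *)
Lemma schwarz g U q v w : open U -> U q -> C2_on U g ->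
  'D_v ('D_w g) q = 'D_w ('D_v g) q.
Proof.
move=> oU Uq C2; apply/eqP; rewrite -subr_eq0 -normr_eq0; apply/eqP/le_anti.
rewrite normr_ge0 andbT; apply/ler_addgt0Pl => e e0; rewrite addr0.
have e2 : 0 < e / 2 by rewrite divr_gt0.
have [_ C2'] := C2.
have near_q a b : \forall x \near q, `|'D_a ('D_b g) q - 'D_a ('D_b g) x| < e / 2.
  have /cvgrPdist_lt := (C2' b q Uq).2 a.
  exact.
have nU : \forall x \near q, U x by exact: open_nbhs_nbhs.
have nA : \forall x \near q, [/\ U x, `|'D_v ('D_w g) q - 'D_v ('D_w g) x| < e / 2 &
    `|'D_w ('D_v g) q - 'D_w ('D_v g) x| < e / 2].
  have nvw := near_q v w. have nwv := near_q w v.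
  apply: filterS2 (filterI nU nvw) nwv.
  by move=> x [].
have [k [k0 [A1 A2]]] := filter_ex (filterI (nbhs_right_gt (0 : R))
  (filterI (parallelogram_nbhs v w nA) (parallelogram_nbhs w v nA))).
have [|s [t [s0 t0 E1]]] := second_difference C2 (ltW k0) (v := v) (w := w) (q := q).
  by move=> s t s0 t0; have [] := A1 s t s0 t0.
have [|s' [t' [s'0 t'0 E2]]] := second_difference C2 (ltW k0) (v := w) (w := v) (q := q).
  by move=> a b a0 b0; have [] := A2 a b a0 b0.
move: E1 E2 (A1 s t s0 t0) (A2 s' t' s'0 t'0); rewrite (addrAC q (k *: w)).
move: ('D_w ('D_v g) (q + s *: v + t *: w)) ('D_v ('D_w g) (q + s' *: w + t' *: v))
  ('D_v ('D_w g) q) ('D_w ('D_v g) q) => X Y a b.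
move: (g _) (g _) (g _) (g _) => ga gb gc gd E1 E2 [_ _ h1] [_ h2 _].
have XY : X = Y.
  by apply: (@mulfI _ (k ^+ 2)); rewrite ?gt_eqF ?exprn_gt0// -E1 -E2; ring.
move: h1 h2; rewrite !ltr_norml ler_norml XY; lra.
Qed.

Lemma derive2_sum g U q h : open U -> U q -> C2_on U g ->
  'D_h ('D_h g) q = \sum_i \sum_j
    (h 0 i * h 0 j) * 'D_(delta_mx 0 j) ('D_(delta_mx 0 i) g) q.
Proof.
move=> oU Uq C2; have dD v : differentiable ('D_v g) q by have [] := C2.2 v q Uq.
rewrite derive_grad//; apply: eq_bigr => i _; rewrite mxE.
rewrite (schwarz _ _ oU Uq C2) derive_grad// mulrC mulr_sumr.
by apply: eq_bigr => j _; rewrite mxE mulrCA mulrC.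
Qed.

Lemma coord_mul_le h i j : `|h 0 i * h 0 j| <= dotp h h.
Proof.
have sq k : h 0 k ^+ 2 <= dotp h h.
  rewrite /dotp (bigD1 k)//= -expr2 lerDl sumr_ge0// => l _.
  by rewrite -expr2 sqr_ge0.
have := sq i; have := sq j.
move: (h 0 i) (h 0 j) => a b ha hb; rewrite ler_norml; apply/andP; split; nra.
Qed.

(** The bound is uniform in h because the second derivatives in all directions
    are combinations of finitely many partial ones. *)
Lemma derive2_near g U q (e : R) : open U -> U q -> C2_on U g -> 0 < e ->
  \forall x \near q, U x /\ forall h,
    'D_h ('D_h g) q - e * dotp h h <= 'D_h ('D_h g) x.
Proof.
move=> oU Uq C2 e0.
pose H (i j : 'I_N) x := 'D_(delta_mx 0 j) ('D_(delta_mx 0 i) g) x.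
have cH : \sum_i \sum_j `|H i j q - H i j x| @[x --> nbhs q] --> (0 : R).
  suff : \sum_i \sum_j `|H i j q - H i j x| @[x --> nbhs q]
     --> \sum_i \sum_j `|H i j q - H i j q|.
    rewrite [X in _ --> X]big1// => i _; apply: big1 => j _.
    by rewrite subrr normr0.
  apply: cvg_big => [|i _]; first exact: add_continuous.
  apply: cvg_big => [|j _]; first exact: add_continuous.
  apply: cvg_norm; apply: cvgB; first exact: cvg_cst.
  exact: ((C2.2 (delta_mx 0 i) q Uq).2 (delta_mx 0 j)).
near=> x.
have Ux : U x by near: x; exact: open_nbhs_nbhs.
split => // h; rewrite (derive2_sum _ oU Uq C2) (derive2_sum _ oU Ux C2).
have : \sum_i \sum_j `|H i j q - H i j x| < e by near: x; exact: (cvgr_lt 0).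
move=> He; rewrite lerBlDr -lerBlDl.
have hh := dotp_ge0 h.
apply: (@le_trans _ _ ((\sum_i \sum_j `|H i j q - H i j x|) * dotp h h)); last first.
  by apply: ler_wpM2r => //; exact: ltW.
rewrite -sumrB mulr_suml; apply: ler_sum => i _.
rewrite -sumrB mulr_suml; apply: ler_sum => j _.
rewrite -mulrBr (le_trans (ler_norm _))// normrM mulrC.
by apply: ler_wpM2l => //; exact: coord_mul_le.
Unshelve. all: by end_near. Qed.

End Directional.
End Calculus.

(** * The derivative of the unit normal *)

Section Normal.
Context {R : realType} {N : nat}.
Implicit Types (g : 'rV[R]_N -> R) (x q v w h : 'rV[R]_N) (U : set 'rV[R]_N).

Lemma enorm_gt0 v : (0 < enorm v) = (v != 0).
Proof. by rewrite /enorm sqrtr_gt0 dotp_gt0. Qed.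

Lemma enorm_sqr v : enorm v ^+ 2 = dotp v v.
Proof. by rewrite sqr_sqrtr// dotp_ge0. Qed.

Lemma dotp_unit_normal g x : grad g x != 0 ->
  dotp (unit_normal g x) (unit_normal g x) = 1.
Proof.
rewrite -enorm_gt0 => G0; rewrite /unit_normal dotpZl dotpZr -enorm_sqr.
by field; rewrite gt_eqF.
Qed.

Lemma differentiable_inv_enorm_grad g U q : U q -> C2_on U g -> grad g q != 0 ->
  differentiable (fun x => (enorm (grad g x))^-1) q.
Proof.
move=> Uq C2 g0.
have dS : differentiable (fun x => dotp (grad g x) (grad g x)) q.
  rewrite (_ : (fun _ => _) = \sum_(i < N)
    ('D_(delta_mx 0 i) g * 'D_(delta_mx 0 i) g : 'rV[R]_N -> R)); last first.
    by apply/funext => x; rewrite fct_sumE; apply: eq_bigr => i _; rewrite !mxE.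
  apply: differentiable_sum => i.
  by apply: differentiableM; have [] := C2.2 (delta_mx 0 i) q Uq.
apply: differentiableV; last by rewrite gt_eqF// enorm_gt0.
apply: (@differentiable_comp _ _ _ _ (fun x => dotp (grad g x) (grad g x)) Num.sqrt) => //.
apply/derivable1_diffP.
by apply: (@ex_derive _ _ _ _ _ _ _ (is_derive1_sqrt _)); rewrite dotp_gt0.
Qed.

Lemma differentiable_unit_normal g U q : U q -> C2_on U g -> grad g q != 0 ->
  differentiable (unit_normal g) q.
Proof.
move=> Uq C2 g0.
rewrite (_ : unit_normal g = \sum_(i < N) (fun x =>
    (((fun x => (enorm (grad g x))^-1) * 'D_(delta_mx 0 i) g : 'rV[R]_N -> R) x)
      *: (delta_mx 0 i : 'rV[R]_N))); last first.
  apply/funext => x; rewrite fct_sumE [LHS]row_sum_delta.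
  by apply: eq_bigr => i _; rewrite !mxE.
apply: differentiable_sum => i; apply: differentiableZl.
apply: differentiableM; first exact: differentiable_inv_enorm_grad C2 g0.
by have [] := C2.2 (delta_mx 0 i) q Uq.
Qed.

(** The shape operator is the tangential part of the Hessian, divided by the
    length of the gradient.  The derivative of the factor 1 / |grad g| contributes
    a multiple of the normal only, and that multiple is determined by the fact
    that a unit vector field is orthogonal to its derivatives. *)
Lemma derive_unit_normal g U q v : open U -> U q -> C2_on U g ->
  (forall x, U x -> grad g x != 0) ->
  'D_v (unit_normal g) q = (enorm (grad g q))^-1 *:
    (grad ('D_v g) q - dotp (grad ('D_v g) q) (unit_normal g q) *: unit_normal g q).
Proof.
move=> oU Uq C2 gU; set n := unit_normal g q; set H := grad ('D_v g) q.
pose a x := (enorm (grad g x))^-1.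
have dn := differentiable_unit_normal Uq C2 (gU q Uq).
have nn : dotp n n = 1 by exact: dotp_unit_normal (gU q Uq).
have G0 : 0 < enorm (grad g q) by rewrite enorm_gt0 gU.
have Dcoord i : 'D_v (unit_normal g) q 0 i = 'D_v (fun x => unit_normal g x 0 i) q.
  by rewrite derive_mx ?mxE//; exact: diff_derivable.
have [b nE] : exists b, 'D_v (unit_normal g) q = a q *: H + b *: n.
  exists ('D_v a q * enorm (grad g q)); apply/rowP => i; rewrite Dcoord !mxE.
  rewrite (_ : (fun x => _) = a * 'D_(delta_mx 0 i) g); last first.
    by apply/funext => x; rewrite !mxE.
  rewrite deriveM; last 2 first.
  - exact/diff_derivable/(differentiable_inv_enorm_grad Uq C2 (gU q Uq)).
  - by apply: diff_derivable; have [] := C2.2 (delta_mx 0 i) q Uq.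
  rewrite (schwarz _ _ oU Uq C2) /GRing.scale/=; field; exact: lt0r_neq0.
have orth : dotp ('D_v (unit_normal g) q) n = 0.
  have : 'D_v (fun x => dotp (unit_normal g x) (unit_normal g x)) q = 0.
    rewrite -(derive_cst (1 : R) q v); apply: near_eq_derive.
    near=> x; apply: dotp_unit_normal; apply: gU.
    by near: x; exact: open_nbhs_nbhs.
  have dni i : derivable (fun x => unit_normal g x 0 i) q v.
    by have /derivable_mxP : derivable (unit_normal g) q v; [exact: diff_derivable|exact].
  rewrite (_ : (fun _ => _) = \sum_(i < N)
    ((fun x => unit_normal g x 0 i) * (fun x => unit_normal g x 0 i))); last first.
    by apply/funext => x; rewrite fct_sumE.
  rewrite derive_sum; last by move=> i; apply: derivableM.
  rewrite (eq_bigr (fun i => 2 * ('D_v (unit_normal g) q 0 i * n 0 i))); last first.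
    by move=> i _; rewrite deriveM// Dcoord /GRing.scale/= /n; ring.
  rewrite -mulr_sumr => /eqP; rewrite mulf_eq0 pnatr_eq0 /= => /eqP.
  exact.
clearbody n H; move: orth; rewrite nE dotpDl !dotpZl nn mulr1 => /eqP.
rewrite addrC addr_eq0 => /eqP ->.
by rewrite scalerBr scaleNr scalerA.
Unshelve. all: by end_near. Qed.

End Normal.

(** * Curvature and the tangential Hessian *)

Section Curvature.
Context {R : realType} {N : nat}.
Implicit Types (g : 'rV[R]_N -> R) (x q v w h : 'rV[R]_N) (U Omega : set 'rV[R]_N).

Lemma derive_combination (f : 'rV[R]_N -> R) q v w (t : R) : differentiable f q ->
  'D_(v + t *: w) f q = 'D_v f q + t * 'D_w f q.
Proof. by move=> df; rewrite !derive_grad// dotpDr dotpZr. Qed.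

Lemma derive2_combination g U q v w (t : R) : open U -> U q -> C2_on U g ->
  'D_(v + t *: w) ('D_(v + t *: w) g) q =
  'D_v ('D_v g) q + 2 * t * 'D_w ('D_v g) q + t ^+ 2 * 'D_w ('D_w g) q.
Proof.
move=> oU Uq C2; have dD u : differentiable ('D_u g) q by have [] := C2.2 u q Uq.
set u := v + t *: w.
have uE x : 'D_u ('D_x g) q = 'D_v ('D_x g) q + t * 'D_w ('D_x g) q.
  exact: derive_combination.
have xu x : 'D_x ('D_u g) q = 'D_u ('D_x g) q := schwarz x u oU Uq C2.
have vw : 'D_v ('D_w g) q = 'D_w ('D_v g) q := schwarz v w oU Uq C2.
rewrite uE; move: (xu v) (xu w) => -> ->; rewrite (uE v) (uE w) vw.
move: ('D_v ('D_v g) q) ('D_w ('D_v g) q) ('D_w ('D_w g) q) => a b c.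
by ring.
Qed.

Lemma derive2_scale g U q v (t : R) : open U -> U q -> C2_on U g ->
  'D_(t *: v) ('D_(t *: v) g) q = t ^+ 2 * 'D_v ('D_v g) q.
Proof.
move=> oU Uq C2; have dD u : differentiable ('D_u g) q by have [] := C2.2 u q Uq.
have := derive2_combination 0 v t oU Uq C2; rewrite add0r => ->.
by rewrite derive0 (schwarz v 0 oU Uq C2) derive0 mulr0 !add0r.
Qed.

Lemma quadratic_ge0_linear0 (a b : R) : (forall t, 0 <= 2 * t * a + t ^+ 2 * b) -> a = 0.
Proof.
move=> ab; apply/eqP; apply: contraT => a0.
have B0 : 0 < `|b| + 1 by rewrite ltr_wpDl.
have := ab (- a / (`|b| + 1)); rewrite leNgt => /negP; case.
have a2 : 0 < a ^+ 2 by rewrite lt0r sqrf_eq0 a0 sqr_ge0.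
set B := `|b| + 1 in B0 *.
rewrite (_ : _ + _ = a ^+ 2 * (b - 2 * B) / B ^+ 2); last by field; exact: lt0r_neq0.
rewrite pmulr_llt0 ?invr_gt0 ?exprn_gt0// pmulr_rlt0//.
have := ler_norm b; have := normr_ge0 b; rewrite /B; lra.
Qed.

Lemma unit_tangent_compact v : compact [set u | dotp u u = 1 /\ dotp u v = 0].
Proof.
apply: bounded_closed_compact.
  exists 1; split; first exact: num_real.
  move=> M M1 u [uu _] /=; rewrite [leLHS]/Num.Def.normr/= mx_normrE.
  apply: bigmax_le => [|[i j] _ /=]; first exact: ltW (lt_trans ltr01 M1).
  apply: le_trans (ltW M1); rewrite -(@ler_pXn2r _ 2)// ?nnegrE// expr1n.
  rewrite -normrX ger0_norm ?sqr_ge0//.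
  have := coord_mul_le u j j; rewrite uu (ord1 i) -expr2 => /(le_trans (ler_norm _)).
  exact.
rewrite (_ : [set _ | _] = (fun u => dotp u u) @^-1` [set 1] `&`
   (fun u => dotp u v) @^-1` [set 0])//.
apply: closedI.
  apply: (closed_comp _ (@closed_eq R 1)) => u _.
  by apply: (@cvg_dotp _ _ _ (nbhs u) _ id id u u); exact: cvg_id.
apply: (closed_comp _ (@closed_eq R 0)) => u _.
by apply: (@cvg_dotp _ _ _ (nbhs u) _ id (cst v) u v); [exact: cvg_id|exact: cvg_cst].
Qed.

(** The second derivative attains its minimum mu on the compact unit sphere of the
    tangent space at some v0.  Since the Hessian is symmetric, v0 is a critical
    point exactly when the tangential part of the Hessian maps it to mu v0, so
    that mu / |grad g| is an eigenvalue of the shape operator. *)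
Lemma tangential_hessian_ge g U q (kappa : R) :
  (2 <= N)%N -> open U -> U q -> C2_on U g -> (forall x, U x -> grad g x != 0) ->
  (forall v k, v != 0 -> dotp (unit_normal g q) v = 0 ->
     'd (unit_normal g) q v = k *: v -> kappa <= k) ->
  forall v, dotp v (unit_normal g q) = 0 ->
    kappa * enorm (grad g q) * dotp v v <= 'D_v ('D_v g) q.
Proof.
move=> N2 oU Uq C2 gU curv.
have dD u : differentiable ('D_u g) q by have [] := C2.2 u q Uq.
have G0 : 0 < enorm (grad g q) by rewrite enorm_gt0 gU.
set n := unit_normal g q.
have nn : dotp n n = 1 by exact: dotp_unit_normal (gU q Uq).
have nE : unit_normal g q = n by [].
clearbody n.
have cf : continuous (fun v => 'D_v ('D_v g) q).
  pose c (i j : 'I_N) := 'D_(delta_mx 0 j) ('D_(delta_mx 0 i) g) q.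
  rewrite (_ : (fun v => _) = fun v => \sum_i \sum_j (v 0 i * v 0 j) * c i j); last first.
    by apply/funext => u; exact: (derive2_sum u oU Uq C2).
  move=> v.
  suff : \sum_i \sum_j (u 0 i * u 0 j) * c i j @[u --> nbhs v]
    --> \sum_i \sum_j (v 0 i * v 0 j) * c i j by [].
  apply: cvg_big => [|i _]; first exact: add_continuous.
  apply: cvg_big => [|j _]; first exact: add_continuous.
  apply: cvgM; last exact: cvg_cst.
  by apply: cvgM; exact: coord_continuous.
have [w ww wn] := exists_unit_orthogonal n N2.
have [||v0 /set_mem[v0v0 v0n] v0min] :=
  @compact_EVT_min _ _ (fun v => 'D_v ('D_v g) q) _ _ (@unit_tangent_compact n).
- by exists w.
- exact: continuous_subspaceT.
have nv0 : dotp n v0 = 0 by rewrite dotpC.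
set mu := 'D_v0 ('D_v0 g) q in v0min.
have mu_min v : dotp v n = 0 -> mu * dotp v v <= 'D_v ('D_v g) q.
  move=> vn; have [->|vN0] := eqVneq v 0.
    by rewrite derive_grad// -(scale0r 0) !dotpZr !mul0r mulr0.
  have e0 : 0 < enorm v by rewrite enorm_gt0.
  have vE : v = enorm v *: ((enorm v)^-1 *: v).
    by rewrite scalerA divff ?scale1r ?gt_eqF.
  rewrite [in leRHS]vE (derive2_scale _ _ oU Uq C2) -enorm_sqr mulrC.
  apply: ler_wpM2l; first exact: sqr_ge0.
  apply: v0min; apply/mem_set; split; last by rewrite dotpZl vn mulr0.
  by rewrite dotpZl dotpZr -enorm_sqr; field; rewrite gt_eqF.
set H := grad ('D_v0 g) q.
have crit w' : dotp w' n = 0 -> dotp H w' = mu * dotp v0 w'.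
  move=> w'n; apply/eqP; rewrite -subr_eq0; apply/eqP.
  apply: (@quadratic_ge0_linear0 _ ('D_w' ('D_w' g) q - mu * dotp w' w')) => t.
  have := mu_min (v0 + t *: w'); rewrite dotpDl dotpZl w'n mulr0 addr0 => /(_ v0n).
  rewrite (derive2_combination _ _ _ oU Uq C2) (derive_grad w')// -/H -/mu.
  rewrite !dotpE v0v0 (dotpC w' v0); lra.
(* e is tangent, and by crit it is orthogonal to itself. *)
pose e := H - dotp H n *: n - mu *: v0.
have en : dotp e n = 0 by rewrite /e !dotpE nn v0n; ring.
have e0 : e = 0.
  apply/eqP; rewrite -dotp_eq0; apply/eqP; rewrite {1}/e.
  by rewrite 2!dotpDl !dotpNl !dotpZl (dotpC n) en crit//; ring.
have v00 : v0 != 0 by rewrite -dotp_gt0 v0v0 ltr01.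
have kmu : kappa <= (enorm (grad g q))^-1 * mu.
  apply: (curv v0) => //; first by rewrite nE.
  rewrite -deriveE; last exact: differentiable_unit_normal C2 (gU q Uq).
  rewrite (derive_unit_normal _ oU Uq C2 gU) nE -scalerA; congr (_ *: _).
  by apply/eqP; rewrite -subr_eq0 -/e e0.
move=> v vn; apply: le_trans (mu_min v vn).
apply: ler_wpM2r; first exact: dotp_ge0.
by rewrite -ler_pdivlMr// mulrC.
Qed.

End Curvature.

(** * Local support from curvature *)

Section Boundary.
Context {R : realType} {N : nat}.
Implicit Types (g : 'rV[R]_N -> R) (x q v w h : 'rV[R]_N) (U Omega : set 'rV[R]_N).

Lemma local_defining_le0 Omega q U g z : local_defining Omega q U g ->
  U z -> closure Omega z -> g z <= 0.
Proof.
move=> [[oU _] [C1 _] _ gO] Uz clz; rewrite leNgt; apply/negP => gz.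
have /differentiable_continuous cg := (C1 z Uz).1.
have gpos := @cvgr_gt _ _ (nbhs z) _ g (g z) cg 0 gz.
have nU : \forall x \near z, U x by exact: (open_nbhs_nbhs (conj oU Uz)).
have [x [Ox [Ux gx]]] := clz _ (filterI nU (gpos _)).
by have /gO := Ux; move=> [/(_ Ox)]; rewrite ltNge (ltW gx).
Qed.

(** A lower bound on the tangent space extends to all directions at the price of
    an arbitrarily small loss e and of a multiple of the square of the normal
    component; the mixed terms are absorbed by
    2 x y >= - e x^2 - y^2 / e. *)
Lemma hessian_ge_of_tangential g U q (n : 'rV[R]_N) (m e : R) :
  open U -> U q -> C2_on U g -> dotp n n = 1 -> 0 < e -> 0 <= m ->
  (forall v, dotp v n = 0 -> m * dotp v v <= 'D_v ('D_v g) q) ->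
  exists L, 0 <= L /\ forall h,
    (m - e) * dotp h h - L * dotp h n ^+ 2 <= 'D_h ('D_h g) q.
Proof.
move=> oU Uq C2 nn e0 m0 tan.
have dD u : differentiable ('D_u g) q by have [] := C2.2 u q Uq.
pose a := grad ('D_n g) q; pose b := 'D_n ('D_n g) q.
have aa := dotp_ge0 a.
exists (dotp a a / e + `|b| + m); split.
  apply: addr_ge0 => //; apply: addr_ge0 => //.
  by apply: divr_ge0 => //; exact: ltW.
move=> h; set s := dotp h n.
pose v := h + (- s) *: n.
have hE : h = v + s *: n by rewrite /v scaleNr subrK.
have vn : dotp v n = 0 by rewrite /v dotpDl dotpZl nn -/s; ring.
clearbody v s.
have nv : dotp n v = 0 by rewrite dotpC.
have hh : dotp h h = dotp v v + s ^+ 2 by rewrite hE !dotpE vn nv nn; ring.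
have DD : 'D_h ('D_h g) q = 'D_v ('D_v g) q + 2 * s * dotp a v + s ^+ 2 * b.
  rewrite [in LHS]hE (derive2_combination v n s oU Uq C2).
  by rewrite (schwarz n v oU Uq C2) (derive_grad v (dD n)).
have := dotp_ge0 (e *: v + s *: a).
clearbody a b; rewrite !dotpE (dotpC v a) => sq.
rewrite DD hh; have := tan v vn; move: ('D_v ('D_v g) q) => Dv Dv_ge.
have bs : - `|b| * s ^+ 2 <= b * s ^+ 2.
  by apply: ler_wpM2r; [exact: sqr_ge0|rewrite lerNl; have := ler_norm (- b); rewrite normrN].
have sq' : 0 <= e * dotp v v + 2 * s * dotp a v + s ^+ 2 * (dotp a a / e).
  rewrite -(pmulr_rge0 _ e0).
  rewrite [leRHS](_ : _ = e * (e * dotp v v) + s * (e * dotp a v) +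
    (e * (s * dotp a v) + s * (s * dotp a a))); last by field; exact: lt0r_neq0.
  by clear -sq; lra.
have ms : 0 <= e * s ^+ 2 by rewrite mulr_ge0 ?sqr_ge0// ltW.
clear - Dv_ge bs sq' ms.
move: (dotp a a / e) (dotp v v) (dotp a v) (`|b|) Dv_ge bs sq' ms => *.
lra.
Qed.

(** With s = <z - q, nu>, G = |grad g q| and hh = |z - q|^2, Taylor's formula and
    g z <= 0 <= g q give 2 s + mu hh <= L' s^2 for some mu > 1 / r.  For small s
    the right-hand side is negligible against s, so that 2 s is less than
    - hh / r, which is the supporting condition. *)
Lemma local_defining_in_ball Omega q U g (kappa r : R) :
  open Omega -> boundary Omega q -> local_defining Omega q U g ->
  0 < kappa -> kappa^-1 < r ->
  (forall v, dotp v (unit_normal g q) = 0 ->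
    kappa * enorm (grad g q) * dotp v v <= 'D_v ('D_v g) q) ->
  locally_in_ball Omega q (unit_normal g q) r.
Proof.
move=> oO bq ld k0 kr tan; have [[oU Uq] C2 gU gO] := ld.
have nOq : ~ Omega q by case: bq => _; rewrite ((interior_id Omega).1 oO).
have gq : 0 <= g q by rewrite leNgt; apply/negP => /(gO q Uq).
set n := unit_normal g q in tan *; set G := enorm (grad g q) in tan.
have G0 : 0 < G by rewrite enorm_gt0 gU.
have nn : dotp n n = 1 by exact: dotp_unit_normal (gU q Uq).
have gradE : grad g q = G *: n.
  by rewrite /n /unit_normal scalerA divff ?scale1r// gt_eqF.
have r0 : 0 < r by apply: lt_trans kr; rewrite invr_gt0.
have rk : 1 < r * kappa by rewrite -ltr_pdivrMr// div1r.
clearbody n G.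
(* The loss e occurs twice, in the Hessian bound and in Taylor's formula, and
   leaves kappa G - 2 e = mu G, where mu is the mean of kappa and 1 / r. *)
pose e := (kappa - r^-1) * G / 4.
have rinv : r^-1 < kappa by rewrite -div1r ltr_pdivrMr// mulrC.
have e0 : 0 < e by rewrite divr_gt0// mulr_gt0// subr_gt0.
have [L [L0 HL]] : exists L, 0 <= L /\ forall h,
    (kappa * G - e) * dotp h h - L * dotp h n ^+ 2 <= 'D_h ('D_h g) q.
  by apply: (hessian_ge_of_tangential oU Uq C2 nn e0 _ tan); exact/ltW/mulr_gt0.
pose L' := L / G; have L'0 : 0 <= L' by rewrite divr_ge0// ltW.
pose mu := (kappa + r^-1) / 2.
have rmu : 1 < r * mu.
  by rewrite /mu (_ : r * _ = (r * kappa + 1) / 2); [lra|field; rewrite gt_eqF].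
have mu0 : 0 < mu by rewrite divr_gt0// addr_gt0// invr_gt0.
pose tau := Num.min 1 (r * mu - 1) / (L' + 1).
have tau0 : 0 < tau by rewrite divr_gt0// ?lt_min ?ltr01 ?subr_gt0//; lra.
have tau1 : tau * L' < 1 /\ tau * L' < 2 * (r * mu - 1).
  have : tau * (L' + 1) = Num.min 1 (r * mu - 1) by rewrite divfK// lt0r_neq0//; lra.
  have : Num.min 1 (r * mu - 1) <= 1 by rewrite ge_min lexx.
  have : Num.min 1 (r * mu - 1) <= r * mu - 1 by rewrite ge_min lexx orbT.
  move: (Num.min _ _) => T; nra.
have /nbhs_ballP[d /= d0 dH] := derive2_near oU Uq C2 e0.
have small : \forall z \near q, `|dotp (z - q) n| < tau.
  suff cz : dotp (z - q) n @[z --> nbhs q] --> (0 : R).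
    by have := cvgr_norm_lt 0 cz; rewrite normr0 => /(_ _ _ tau0); apply.
  suff : dotp (z - q) n @[z --> nbhs q] --> dotp (q - q) n.
    by rewrite subrr -(scale0r 0) dotpZl mul0r.
  apply: cvg_dotp; last exact: cvg_cst.
  by apply: cvgB; [exact: cvg_id|exact: cvg_cst].
near=> z => clz zq.
have zd : ball q d z by near: z; exact: nbhsx_ballx.
have ztau : `|dotp (z - q) n| < tau by near: z.
have zE : z = q + 1 *: (z - q) by rewrite scale1r addrC subrK.
set h := z - q in ztau zE *.
have seg t : 0 <= t <= 1 -> ball q d (q + t *: h).
  move=> t01; move: zd; rewrite -ball_normE /ball_/= opprD addrA subrr add0r normrN.
  rewrite distrC -/h normrZ; apply: le_lt_trans.
  by rewrite ger0_norm ?ler_piMl//; case/andP: t01.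
have gz : g z <= 0.
  apply: local_defining_le0 ld _ clz.
  by have := (dH _ zd).1.
have h0 : 0 < dotp h h by rewrite dotp_gt0 subr_eq0.
have taylor : g q + 'D_h g q + ('D_h ('D_h g) q - e * dotp h h) / 2 <= g z.
  have := @taylor2_ge _ (fun t => g (q + t *: h)) (fun t => 'D_h g (q + t *: h))
    (fun t => 'D_h ('D_h g) (q + t *: h)) ('D_h ('D_h g) q - e * dotp h h).
  rewrite -zE scale0r addr0; apply => t t01.
  - by apply: is_derive_line; have [] := C2.1 _ (dH _ (seg t t01)).1.
  - by apply: is_derive_line; have [] := C2.2 h _ (dH _ (seg t t01)).1.
  - exact: (dH _ (seg t t01)).2.
have := HL h; move: taylor ztau.
rewrite (derive_grad h (C2.1 q Uq).1) gradE dotpZl (dotpC n).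
move: ('D_h ('D_h g) q) (dotp h h) (dotp h n) (g q) (g z) h0 gq gz.
move=> DD hh s gq gz hh0 gq0 gz0 taylor stau HLh.
have key : 2 * s + mu * hh - L' * s ^+ 2 <= 0.
  rewrite -(pmulr_rle0 _ G0).
  rewrite [leLHS](_ : _ = 2 * (G * s) + ((kappa * G - e) * hh - L * s ^+ 2) -
      e * hh); last first.
    by rewrite /mu /L' /e; field; rewrite !gt_eqF.
  clear -gq0 gz0 taylor HLh; lra.
rewrite ltNge; apply/negP => hs.
have [tL1 tL2] := tau1.
have [s0|s0] := lerP 0 s.
  rewrite ger0_norm// in stau.
  have : L' * s ^+ 2 <= s.
    by rewrite expr2 mulrA -[leRHS]mul1r; apply: ler_wpM2r => //; nra.
  have : 0 < mu * hh by rewrite mulr_gt0.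
  clear -s0 key; lra.
rewrite ltr0_norm// in stau.
have : 0 <= mu * (hh + 2 * r * s) by rewrite mulr_ge0// ltW.
have : L' * s ^+ 2 < 2 * (r * mu - 1) * (- s).
  rewrite (_ : L' * s ^+ 2 = (L' * - s) * - s); last by ring.
  rewrite ltr_pM2r ?oppr_gt0//.
  by apply: le_lt_trans tL2; rewrite mulrC; apply: ler_wpM2r => //; exact: ltW.
clear -key; lra.
Unshelve. all: by end_near. Qed.

(** The infimum of a set without lower bound is 0 by convention, so positivity of
    the infimum makes it a lower bound. *)
Lemma min_curvature_le Omega q k : 0 < min_curvature Omega ->
  boundary Omega q -> principal_curvature Omega q k -> min_curvature Omega <= k.
Proof.
move=> k0 bq pk; rewrite /min_curvature; apply: ge_inf; last by exists q.
have [[]//|] := pselect (has_inf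
  [set k | exists2 p, boundary Omega p & principal_curvature Omega p k]).
by move=> /inf_out h; move: k0; rewrite /min_curvature h ltxx.
Qed.

End Boundary.

(** * Domains with curvature bounded below *)

Theorem proposition2p7 (R : realType) (N : nat) (hN : (2 <= N)%N)
    (Omega : set 'rV[R]_N)
    (hdom : domain Omega) (hbnd : bounded_set Omega) (hC2 : C2_boundary Omega)
    (hkappa : 0 < min_curvature Omega)
    (r : R) (hr : 1 / min_curvature Omega <= r) :
  class_C r Omega.
Proof.
rewrite div1r in hr.
apply: (class_C_of_local_support hN hdom hbnd _ hr); first by rewrite invr_gt0.
move=> q bq; have [U [g ld]] := hC2 q bq.
have [[oU Uq] C2 gU _] := ld.
exists (unit_normal g q); first exact: dotp_unit_normal (gU q Uq).
move=> r' rr'; apply: (local_defining_in_ball _ bq ld hkappa rr'); first by case: hdom.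
apply: (tangential_hessian_ge hN oU Uq C2 gU) => v k v0 nv dv.
apply: (min_curvature_le hkappa bq).
by exists U, g; split => //; exists v.
Qed.
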